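(* Let $k\ge1$, let $\{\epsilon_i\}$ be an i.i.d. sequence with $\mathbb{E}\epsilon_i=0$, $\mathbb{E}\epsilon_i^2=1$, and let $a:\mathbb{Z}_+^k\to\mathbb{R}$. The polynomial form (with diagonals) $$X=\sum_{0<i_1,\ldots,i_k<\infty}a(i_1,\ldots,i_k)\,\epsilon_{i_1}\cdots\epsilon_{i_k}$$ is a random variable defined in the $L^2(\Omega)$-sense if the following three conditions hold: 1. $\mathbb{E}\epsilon_i^{2k}<\infty$; 2. for any $\pi=\{P_1,\ldots,P_{|\pi|}\}\in\mathcal{P}_k$, $$\sum'_{0<i_1,\ldots,i_{|\pi|}<\infty}a_\pi(i_1,\ldots,i_{|\pi|})^2<\infty;$$ 3. for any $\pi\in\mathcal{P}_k$ and any nonempty $T\subset\{1,\ldots,|\pi|\}$ satisfying $|P_t|\ge2$ for all $t\in T$, $$\sum'_{0<i_1,\ldots,i_{|\pi|-|T|}<\infty}\big[(S'_T|a_\pi|)(i_1,\ldots,i_{|\pi|-|T|})\big]^2<\infty,$$ where, if $|T|=|\pi|$, this is understood as merely stating that the sum $S'_T|a_\pi|$ converges.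
   Context: Notation: $\mathbb{Z}_+=\{1,2,\ldots\}$. A prime on a sum ($\sum'$) means that the summation is only over index vectors with pairwise distinct components. $\mathcal{P}_k$ is the set of all partitions of $\{1,\ldots,k\}$; $|\pi|$ is the number of blocks of $\pi=\{P_1,\ldots,P_{|\pi|}\}$, with blocks ordered according to their smallest element. $a_\pi$ is the function of $m=|\pi|$ variables $a_\pi(i_1,\ldots,i_m)=a(\mathbf{i}_\pi)$, where $\mathbf{i}_\pi\in\mathbb{Z}_+^k$ has $q$-th component $i_t$ whenever $q\in P_t$; $|a_\pi|$ is its absolute value. For $T\subset\{1,\ldots,|\pi|\}$, $S'_T|a_\pi|$ is the function of $|\pi|-|T|$ variables obtained by summing $|a_\pi|$ over its variables with indices in $T$, off-diagonally: the summed variables are required to be pairwise distinct and distinct from all remaining variables. ''Defined in the $L^2(\Omega)$-sense'' means that the partial sums $X_M=\sum_{1\le i_1,\ldots,i_k\le M}a(i_1,\ldots,i_k)\epsilon_{i_1}\cdots\epsilon_{i_k}$ converge in $L^2(\Omega)$ as $M\to\infty$. *)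

(* Defs.v *)
From mathcomp Require Import all_boot all_order all_algebra finmap.
From mathcomp Require Import all_classical all_reals all_analysis.

Set Implicit Arguments.
Unset Strict Implicit.
Unset Printing Implicit Defensive.

Import Order.TTheory GRing.Theory Num.Theory.
Import numFieldNormedType.Exports.

Local Open Scope classical_set_scope.
Local Open Scope ring_scope.

(* Positive integers are relabelled by [nat], with n standing for n + 1; the
   range 1 <= i <= M becomes i < M.  A function on Z_+^k is a function on
   [k.-tuple nat], and 1, ..., k become the elements of ['I_k]. *)

Section Probability.
Context (d : measure_display) (T : measurableType d) (R : realType).
Variable P : probability T R.

Definition mutually_independent (eps : nat -> {RV P >-> R}) : Prop :=
  forall (J : {fset nat}) (A : nat -> set R),
    (forall j, measurable (A j)) ->
    P (\bigcap_(j in [set` J]) (eps j @^-1` A j))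
    = (\prod_(j <- J) P (eps j @^-1` A j))%E.

Definition identically_distributed (eps : nat -> {RV P >-> R}) : Prop :=
  forall (i j : nat) (A : set R), measurable A ->
    distribution P (eps i) A = distribution P (eps j) A.

Definition iid (eps : nat -> {RV P >-> R}) : Prop :=
  mutually_independent eps /\ identically_distributed eps.

Definition converges_in_L2 (X_ : nat -> T -> R) : Prop :=
  (forall M, X_ M \in Lfun P 2%:E) /\
  exists2 X : T -> R, X \in Lfun P 2%:E &
    ('N[P]_2%:E[EFin \o (X_ M \- X)%R])%E @[M --> \oo] --> 0%E.

End Probability.

Section Partitions.
Context (k : nat).
Implicit Types (pi : {set {set 'I_k}}) (B : {set 'I_k}).

(* The default value k only matters for the empty set. *)
Definition min_elt B : nat := \big[minn/k]_(q in B) (q : nat).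

Definition blocks pi : seq {set 'I_k} :=
  sort (fun B C => (min_elt B <= min_elt C)%N) (enum pi).

Definition block pi (t : nat) : {set 'I_k} := nth finset.set0 (blocks pi) t.

Definition block_index pi (q : 'I_k) : nat :=
  index (finset.pblock pi q) (blocks pi).

(* The vector i_pi, whose q-th component is i_t for q in the t-th block; the
   default value 0 is never used when pi is a partition. *)
Definition expand pi (i : #|pi|.-tuple nat) : k.-tuple nat :=
  [tuple nth 0%N i (block_index pi q) | q < k].

Lemma size_blocks pi : size (blocks pi) = #|pi|.
Proof. by rewrite size_sort -cardE. Qed.

Lemma block_index_lt pi (q : 'I_k) :
  finset.partition pi [set: 'I_k]%SET -> (block_index pi q < #|pi|)%N.
Proof.
move=> /and3P[/eqP pi_cover _ _].
rewrite -size_blocks index_mem mem_sort mem_enum finset.pblock_mem//.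
by rewrite pi_cover inE.
Qed.

Lemma mem_block_index pi (q : 'I_k) :
  finset.partition pi [set: 'I_k]%SET -> q \in block pi (block_index pi q).
Proof.
move=> ppi; rewrite /block nth_index ?finset.mem_pblock.
  by case/and3P: ppi => /eqP -> _ _; rewrite inE.
by rewrite -index_mem size_blocks; exact: block_index_lt.
Qed.

End Partitions.

Section Coefficients.
Context (R : realType) (k : nat).
Variable a : k.-tuple nat -> R.
Implicit Types (pi : {set {set 'I_k}}).

Definition coeff pi (i : #|pi|.-tuple nat) : R := a (expand i).

(* S'_T |a_pi| as a function of the values j of the remaining variables, which
   are listed in increasing order of their index. *)
Definition offdiag_sum pi (T : {set 'I_#|pi|})
    (j : (#|pi| - #|T|).-tuple nat) : \bar R :=
  \esum_(i in [set i : #|pi|.-tuple nat |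
      [seq tnth i t | t <- enum (~: T)%SET] = j :> seq nat /\
      forall s t, s \in T -> s != t -> tnth i s != tnth i t])
    (`|coeff i|)%:E.
Arguments offdiag_sum [pi] T j.

Definition summable_sq pi : Prop :=
  (\esum_(i in [set i : #|pi|.-tuple nat | uniq i]) (coeff i ^+ 2)%:E
   < +oo)%E.

Definition summable_offdiag pi (T : {set 'I_#|pi|}) : Prop :=
  (\esum_(j in [set j : (#|pi| - #|T|).-tuple nat | uniq j])
     offdiag_sum T j ^+ 2 < +oo)%E.

(* If T contains all the indices, j can only be the empty tuple and the
   condition says that the sum S'_T |a_pi| converges. *)
Lemma summable_offdiag_full pi (T : {set 'I_#|pi|}) :
  #|T| = #|pi| ->
  summable_offdiag T <-> forall j, (offdiag_sum T j < +oo)%E.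
Proof.
move=> Tpi.
have f_ge0 j : (0 <= offdiag_sum T j)%E.
  by apply: esum_ge0 => i _; rewrite lee_fin.
rewrite /summable_offdiag; move: (offdiag_sum T) f_ge0.
rewrite Tpi subnn => f f_ge0.
have -> : [set j : 0.-tuple nat | uniq j] = [set [tuple]].
  by apply/seteqP; split=> j /= _; [exact: tuple0|rewrite (tuple0 j)].
rewrite esum_set1 ?expe_ge0//.
have sqf : (f [tuple] ^+ 2 < +oo)%E <-> (f [tuple] < +oo)%E.
  by case: (f [tuple]) (f_ge0 [tuple]) => [r _| |//]; rewrite ?expe2 ?ltry.
by rewrite sqf; split=> [h j|//]; rewrite (tuple0 j).
Qed.

End Coefficients.
Arguments offdiag_sum [R k] a [pi] T j.

Section PolynomialForm.
Context (T : Type) (R : realType) (k : nat).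

Definition polynomial_form (a : k.-tuple nat -> R) (eps : nat -> T -> R)
    (M : nat) (w : T) : R :=
  \sum_(i : k.-tuple 'I_M)
    a (map_tuple val i) * \prod_(q < k) eps (tnth i q) w.

End PolynomialForm.

(* Main.v *)
Require Import Defs.
From mathcomp Require Import all_boot all_order all_algebra finmap.
From mathcomp Require Import all_classical all_reals all_analysis.
From mathcomp Require Import measurable_realfun ring.

Set Implicit Arguments.
Unset Strict Implicit.
Unset Printing Implicit Defensive.

Import Order.TTheory GRing.Theory Num.Theory.
Import numFieldNormedType.Exports.

Local Open Scope classical_set_scope.
Local Open Scope ring_scope.

(** Independence makes the expectation of a product of [eps]'s over an index
    vector of length 2k vanish as soon as some index occurs exactly once, and it
    is bounded by 2k times the common 2k-th moment otherwise.  Hence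
    E (X_M - X_N)^2 <= C (S_M - S_N), where S_M sums |a(i)| |a(j)| over the pairs
    (i, j) of index vectors below M such that no value occurs exactly once in the
    concatenation of i and j; by completeness of L^2 it is enough to bound S_M.

    Group the pairs by the set V of values common to i and j.  A value of i
    outside V is repeated in i, and likewise for j, so S_M is at most the sum over
    V of the square of the sum of |a(i)| over the i that contain V and repeat all
    their other values.  Such an i determines the partition pi of {1, ..., k} into
    its level sets and the set T of blocks of pi whose value is not in V; these
    blocks have at least two elements.  For given pi, T and given values of the
    blocks outside T, which enumerate V, the sum of |a(i)| is at most S'_T|a_pi|.
    As there are finitely many pi, T and enumerations of V, the Cauchy-Schwarz
    inequality reduces the bound to the summability hypotheses. *)

(** * Level sets of an index vector *)

Section Kernel.
Context (k : nat) (q0 : 'I_k) (A : eqType).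
Implicit Types (i : k.-tuple A) (pi : {set {set 'I_k}}).

Definition kernel_partition i : {set {set 'I_k}} :=
  preim_partition (tnth i) [set: 'I_k]%SET.

(** The default [q0] is reached only for an empty block, hence never for an index [t < #|pi|] of a
    partition. *)
Definition block_rep pi (t : nat) : 'I_k := odflt q0 [pick q in block pi t].

(** When the level sets of [i] form [pi], [expand] recovers [i] from this tuple. *)
Definition block_values pi i : #|pi|.-tuple A :=
  [tuple tnth i (block_rep pi t) | t < #|pi|].

Lemma kernel_partitionP i :
  finset.partition (kernel_partition i) [set: 'I_k]%SET.
Proof. exact: preim_partitionP. Qed.

Lemma mem_block pi t : (t < #|pi|)%N -> block pi t \in pi.
Proof.
move=> tpi; rewrite -mem_enum.
rewrite -(mem_sort (fun B C => (min_elt B <= min_elt C)%N)).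
by rewrite mem_nth// size_blocks.
Qed.

Lemma block_repP pi t : finset.partition pi [set: 'I_k]%SET -> (t < #|pi|)%N ->
  block_rep pi t \in block pi t.
Proof.
move=> /and3P[_ _ n0] /mem_block tpi; rewrite /block_rep.
case: pickP => [//|b0]; move: n0.
suff -> : finset.set0 = block pi t by rewrite tpi.
by apply/setP => q; rewrite inE; have := b0 q => ->.
Qed.

Lemma block_kernel i pi (t : 'I_#|pi|) q : kernel_partition i = pi ->
  (q \in block pi t) = (tnth (block_values pi i) t == tnth i q).
Proof.
move=> ipi; case: pi / ipi t => t.
have ppi := kernel_partitionP i; rewrite tnth_mktuple.
have rt := block_repP ppi (ltn_ord t).
have /and3P[_ tI _] := ppi.
rewrite -(def_pblock tI (mem_block (ltn_ord t)) rt).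
rewrite /kernel_partition /preim_partition pblock_equivalence_partition ?inE//.
by move=> x y z _ _ _; split=> // /eqP ->.
Qed.

Lemma nth_block_values i pi x0 q : kernel_partition i = pi ->
  nth x0 (block_values pi i) (block_index pi q) = tnth i q.
Proof.
move=> ipi; have ppi := kernel_partitionP i; rewrite ipi in ppi.
have lt := block_index_lt q ppi.
have := mem_block_index q ppi.
by rewrite (block_kernel (Ordinal lt) _ ipi) => /eqP <-; rewrite (tnth_nth x0).
Qed.

(** If two blocks had the same value, the representative of one would lie in the other; blocks are
    disjoint and listed without repetition. *)
Lemma uniq_block_values i pi : kernel_partition i = pi ->
  uniq (block_values pi i).
Proof.
move=> ipi; have ppi := kernel_partitionP i; rewrite ipi in ppi.
have /and3P[_ tI _] := ppi.
apply/(tuple_uniqP (block_values pi i)) => s t st.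
have rs : block_rep pi s \in block pi s by exact: block_repP.
have rt : block_rep pi s \in block pi t.
  by rewrite (block_kernel t _ ipi) -st tnth_mktuple eqxx.
have e : block pi s = block pi t.
  by rewrite -(def_pblock tI _ rs) ?mem_block// (def_pblock tI _ rt) ?mem_block.
apply/val_inj/eqP; move/eqP: e; rewrite /block nth_uniq ?size_blocks//.
by rewrite sort_uniq enum_uniq.
Qed.

Lemma count_block_values i pi (t : 'I_#|pi|) : kernel_partition i = pi ->
  count_mem (tnth (block_values pi i) t) i = #|block pi t|.
Proof.
move=> ipi; rewrite -sum1_count big_tuple sum1_card.
by apply: eq_card => q; rewrite (block_kernel t _ ipi) eq_sym.
Qed.

Lemma mem_block_values i pi : kernel_partition i = pi ->
  block_values pi i =i i.
Proof.
move=> ipi x; apply/tnthP/tnthP => [[t ->]|[q ->]].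
  by exists (block_rep pi t); rewrite tnth_mktuple.
have ppi := kernel_partitionP i; rewrite ipi in ppi.
by exists (Ordinal (block_index_lt q ppi)); 
  rewrite (tnth_nth x (block_values _ _)) nth_block_values.
Qed.

End Kernel.

Lemma expand_block_values k (q0 : 'I_k) M (i : k.-tuple 'I_M) pi :
  kernel_partition i = pi ->
  Defs.expand (map_tuple val (block_values q0 pi i)) = map_tuple val i.
Proof.
move=> ipi; apply: eq_from_tnth => q; rewrite tnth_mktuple tnth_map.
have z := tnth i q.
rewrite -(nth_block_values q0 z q ipi) /= (nth_map z)// size_tuple.
rewrite card_ord; apply: block_index_lt; rewrite -ipi.
exact: kernel_partitionP.
Qed.

(** * Cauchy-Schwarz for finite sums and comparison with infinite sums *)

Section FiniteSums.
Context (R : realType).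

Lemma sum_sq_le (I : finType) (P : pred I) (f : I -> R) :
  (\sum_(i | P i) f i) ^+ 2 <= #|P|%:R * \sum_(i | P i) f i ^+ 2.
Proof.
(* The right-hand side becomes a double sum, so that the inequality holds term by term by
   [f i * f j <= (f i ^+ 2 + f j ^+ 2) / 2]. *)
have -> : #|P|%:R * (\sum_(i | P i) f i ^+ 2) =
    \sum_(i | P i) \sum_(j | P j) (f i ^+ 2 + f j ^+ 2) / 2.
  under [RHS]eq_bigr do rewrite -mulr_suml big_split/=.
  rewrite -mulr_suml big_split/= exchange_big/= -mulr2n.
  rewrite -[_ *+ 2]mulr_natr mulfK ?pnatr_eq0//.
  by rewrite sumr_const mulr_natl.
rewrite expr2 mulr_suml; apply: ler_sum => i _; rewrite mulr_sumr.
apply: ler_sum => j _; rewrite ler_pdivlMr// -subr_ge0.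
suff -> : f i ^+ 2 + f j ^+ 2 - f i * f j * 2 = (f i - f j) ^+ 2.
  exact: sqr_ge0.
by rewrite sqrrB mulr_natr addrAC.
Qed.

(** Through the injection [h], the left-hand side is one of the finite sums whose supremum is
    [\esum]. *)
Lemma sum_le_esum (I : finType) (J : choiceType) (P : pred I) (h : I -> J)
    (S : set J) (f : J -> \bar R) :
  {in P &, injective h} -> (forall i, P i -> S (h i)) ->
  (\sum_(i | P i) f (h i) <= \esum_(j in S) f j)%E.
Proof.
move=> hI hS; apply: esum_ge; exists [set` [seq h i | i <- enum P]].
  split; first exact: finite_seq.
  by move=> j /= /mapP[i]; rewrite mem_enum => Pi ->; exact: hS.
rewrite -fsbig_seq ?big_map ?big_enum//.
by rewrite map_inj_in_uniq ?enum_uniq// => x y; rewrite !mem_enum; exact: hI.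
Qed.

End FiniteSums.

(** * Bounds for the index vectors with a given partition and given values off [T] *)

Section Summability.
Context (R : realType) (k : nat) (q0 : 'I_k) (a : k.-tuple nat -> R).
Implicit Types (pi : {set {set 'I_k}}).

Definition repeated_off M (V : {set 'I_M}) (i : k.-tuple 'I_M) : bool :=
  [forall x in V, x \in i] &&
  [forall x in i, (x \notin V) ==> (1 < count_mem x i)%N].

Definition off_blocks M (V : {set 'I_M}) pi (i : k.-tuple 'I_M) :
    {set 'I_#|pi|} :=
  [set t | tnth (block_values q0 pi i) t \notin V].

Lemma size_remaining n (A : finType) (T : {set 'I_n}) (f : 'I_n -> A) :
  size [seq f t | t <- enum (~: T)%SET] == (n - #|T|)%N.
Proof.
by rewrite size_map -cardE -[X in X == _](addKn #|T|) cardsC card_ord.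
Qed.

Definition remaining (A : finType) n (T : {set 'I_n}) (v : n.-tuple A) :
  (n - #|T|).-tuple A := Tuple (size_remaining T (tnth v)).

Lemma uniq_remaining (A : finType) n (T : {set 'I_n}) (v : n.-tuple A) :
  uniq v -> uniq (remaining T v).
Proof.
move=> /tuple_uniqP v_inj; by rewrite /= map_inj_uniq ?enum_uniq.
Qed.

(** [expand] is a left inverse on the vectors whose level sets form [pi]. *)
Lemma inj_block_values M pi :
  {in [pred i : k.-tuple 'I_M | kernel_partition i == pi] &,
    injective (fun i => map_tuple val (block_values q0 pi i))}.
Proof.
move=> i j /eqP ip /eqP jp h.
apply: val_inj; apply: (inj_map val_inj).
have : map_tuple val i = map_tuple val j.
  rewrite -(expand_block_values q0 ip) -(expand_block_values q0 jp).
  by congr Defs.expand.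
by move/(congr1 val).
Qed.

(** For a partition [pi] and a tuple [j] with distinct components, this is S'_T|a_pi| restricted to
    indices below [M], summed over the original index vectors. *)
Definition fiber_sum M pi (T : {set 'I_#|pi|})
    (j : (#|pi| - #|T|).-tuple 'I_M) : R :=
  \sum_(i : k.-tuple 'I_M | (kernel_partition i == pi) &&
      (remaining T (block_values q0 pi i) == j)) `|a (map_tuple val i)|.

(** The vectors of the fiber have different block tuples, and these satisfy the off-diagonal
    constraint because distinct blocks carry distinct values. *)
Lemma fiber_sum_le_offdiag M pi (T : {set 'I_#|pi|})
    (j : (#|pi| - #|T|).-tuple 'I_M) :
  ((fiber_sum j)%:E <= offdiag_sum a T (map_tuple val j))%E.
Proof.
rewrite /fiber_sum -sumEFin.
pose h (i : k.-tuple 'I_M) : #|pi|.-tuple nat :=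
    map_tuple val (block_values q0 pi i).
rewrite (eq_bigr (fun i => (`|coeff a (h i)|)%:E)); last first.
  by move=> i /andP[/eqP ip _]; rewrite /coeff expand_block_values.
apply: (@sum_le_esum _ _ _ _ h _ (fun v => (`|coeff a v|)%:E)).
  move=> x y; rewrite !unfold_in => /andP[xp _] /andP[yp _].
  by apply: inj_block_values.
move=> i /andP[/eqP ip /eqP <-]; split.
  rewrite /= -map_comp; apply: eq_map => t /=.
  by rewrite !tnth_map.
move=> s t _; apply: contra => /eqP; rewrite !(tnth_map val) => /val_inj.
have /(tuple_uniqP (block_values q0 pi i)) u := uniq_block_values q0 ip.
by move=> /u ->.
Qed.

(** With no block summed out, [j] determines all block values. The fiber then has at most one
    vector, and the cardinality factor of Cauchy-Schwarz is at most one. *)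
Lemma fiber_sum_set0_sq M pi
    (j : (#|pi| - #|finset.set0 : {set 'I_#|pi|}|).-tuple 'I_M) :
  fiber_sum j ^+ 2 <=
  \sum_(i : k.-tuple 'I_M | (kernel_partition i == pi) &&
    (remaining finset.set0 (block_values q0 pi i) == j)) a (map_tuple val i) ^+ 2.
Proof.
apply: le_trans (sum_sq_le _ _) _.
under eq_bigr do rewrite real_normK ?num_real//.
rewrite ler_piMl ?sumr_ge0// => [i _|]; first exact: sqr_ge0.
rewrite lern1; apply/card_le1_eqP => x y; rewrite !unfold_in.
move=> /andP[xp /eqP xj] /andP[yp /eqP yj].
apply: (@inj_block_values M pi) => //.
have {xj yj} := congr1 val (etrans xj (esym yj)).
rewrite /= finset.setC0 => e.
congr (map_tuple val _); apply/eq_from_tnth => t.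
by move/eq_in_map: e => /(_ t) e; rewrite e// mem_enum inE.
Qed.

Lemma fiber_sum_ge0 M pi (T : {set 'I_#|pi|})
    (j : (#|pi| - #|T|).-tuple 'I_M) :
  0 <= fiber_sum j.
Proof. exact: sumr_ge0. Qed.

(** An empty [T] is handled by square summability of [coeff], a nonempty one by domination by
    [offdiag_sum]. The bound is the full infinite sum, hence uniform in [M]. *)
Lemma fiber_sum_bounded pi (T : {set 'I_#|pi|}) :
  (T == finset.set0 -> summable_sq a pi) ->
  (T != finset.set0 -> summable_offdiag a T) ->
  exists B : R, forall M,
    \sum_(j : (#|pi| - #|T|).-tuple 'I_M | uniq j) fiber_sum j ^+ 2 <= B.
Proof.
move=> sq0 sqT; have [T0|Tn0] := eqVneq T finset.set0.
  have {sqT} := sq0; rewrite T0 => /(_ (eqxx _)) sq.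
  exists (fine (\esum_(i in [set i : #|pi|.-tuple nat | uniq i])
    (coeff a i ^+ 2)%:E)).
  move=> M; rewrite -lee_fin fineK; last first.
    by rewrite ge0_fin_numE// esum_ge0// => i _; rewrite lee_fin sqr_ge0.
  pose h (i : k.-tuple 'I_M) : #|pi|.-tuple nat :=
    map_tuple val (block_values q0 pi i).
  apply: (@le_trans _ _ (\sum_(i : k.-tuple 'I_M | kernel_partition i == pi)
      (coeff a (h i) ^+ 2)%:E)%E).
    rewrite sumEFin lee_fin.
    rewrite [leRHS](partition_big
      (fun i => remaining finset.set0 (block_values q0 pi i)) (fun j => uniq j))/=; last first.
      move=> i /eqP ip; apply: uniq_remaining.
      exact: uniq_block_values.
    apply: ler_sum => j _; apply: le_trans (fiber_sum_set0_sq j) _.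
    apply: ler_sum => i /andP[/eqP ip _].
    by rewrite /h /coeff expand_block_values.
  apply: (@sum_le_esum _ _ _ _ h _ (fun v => (coeff a v ^+ 2)%:E)).
    exact: inj_block_values.
  move=> i /eqP ip; rewrite /= map_inj_uniq; last exact: val_inj.
  exact: uniq_block_values.
have sT := sqT Tn0.
exists (fine (\esum_(j in [set j : (#|pi| - #|T|).-tuple nat | uniq j])
  (offdiag_sum a T j ^+ 2)%E)).
have o0 j : (0 <= offdiag_sum a T j)%E.
  by apply: esum_ge0 => i _; rewrite lee_fin.
move=> M; rewrite -lee_fin fineK; last first.
  by rewrite ge0_fin_numE// esum_ge0// => i _; rewrite expe_ge0.
rewrite -sumEFin.
apply: (@le_trans _ _ (\sum_(j : (#|pi| - #|T|).-tuple 'I_M | uniq j)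
   (offdiag_sum a T (map_tuple val j) ^+ 2))%E).
  apply: lee_sum => j _; rewrite EFin_expe !expe2.
  by apply: lee_pmul; rewrite ?lee_fin ?fiber_sum_ge0// fiber_sum_le_offdiag.
apply: (@sum_le_esum _ _ _ _
  (fun j : (#|pi| - #|T|).-tuple 'I_M => map_tuple val j) _
  (fun v => (offdiag_sum a T v ^+ 2)%E)).
  by move=> x y _ _ /(congr1 val) /(inj_map val_inj) /val_inj.
by move=> j uj /=; rewrite map_inj_uniq//; exact: val_inj.
Qed.

End Summability.

(** * Sum over the sets [V] of common values *)

Section TotalBound.
Context (R : realType) (k : nat) (q0 : 'I_k) (a : k.-tuple nat -> R).
Implicit Types (pi : {set {set 'I_k}}).

(** Such a tuple enumerates [V] without repetition: there is none unless [V] has [m] elements, and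
    then they are among the [m ^_ m] injective tuples over [V]. *)
Lemma card_uniq_tuples_of_set (A : finType) m (V : {set A}) :
  (#|[pred j : m.-tuple A | uniq j & [set x in j]%SET == V]| <= m `!)%N.
Proof.
have [Vm|Vm] := eqVneq #|V| m; last first.
  rewrite eq_card0// => j; apply/negbTE; rewrite !unfold_in /=.
  apply: contra Vm => /andP[uj /eqP <-].
  by rewrite cardsE (card_uniqP uj) size_tuple.
rewrite -ffactnn -[in X in (_ <= X ^_ _)%N]Vm -card_uniq_tuples subset_leq_card//.
apply/fintype.subsetP => j /andP[uj /eqP <-]; rewrite inE uj andbT.
by apply/allP => x xj; change (x \in [set y in j]%SET); rewrite finset.in_set.
Qed.

Lemma block_class_bounded pi (T : {set 'I_#|pi|}) :
  (finset.partition pi [set: 'I_k]%SET -> summable_sq a pi) ->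
  (finset.partition pi [set: 'I_k]%SET -> T != finset.set0 ->
     (forall t, t \in T -> (2 <= #|block pi t|)%N) -> summable_offdiag a T) ->
  exists B : R, forall M,
    \sum_(V : {set 'I_M})
      (\sum_(i | (repeated_off V i && (kernel_partition i == pi)) &&
          (off_blocks q0 V pi i == T)) `|a (map_tuple val i)|) ^+ 2 <= B.
Proof.
move=> sq sT.
have [ppi|npi] := boolP (finset.partition pi [set: 'I_k]%SET); last first.
  exists 0 => M; rewrite big1// => V _; rewrite big1 ?expr0n// => i.
  move=> /andP[/andP[_ /eqP ip] _]; move: npi.
  by rewrite -ip kernel_partitionP.
have [/forall_inP T2|] := boolP [forall t in T, 2 <= #|block pi t|]%N; last first.
  (* A block in [T] carries a value outside [V], which must be repeated in [i]. If some block in [T]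
     has fewer than two elements, all inner sums are therefore empty. *)
  move=> /forall_inPn[t tT t2].
  exists 0 => M; rewrite big1// => V _; rewrite big1 ?expr0n// => i.
  move=> /andP[/andP[/andP[_ /forall_inP D] /eqP ip] /eqP iT].
  have := D (tnth (block_values q0 pi i) t).
  rewrite -(mem_block_values q0 ip) mem_tnth => /(_ isT).
  rewrite (count_block_values q0 t ip) (negbTE t2) implybF.
  by move: tT; rewrite -iT inE => ->.
have [B bB] : exists B : R, forall M,
    \sum_(j : (#|pi| - #|T|).-tuple 'I_M | uniq j) fiber_sum q0 a j ^+ 2 <= B.
  by apply: fiber_sum_bounded => [_|Tn]; [exact: sq|exact: sT].
(* The factorial bounds the number of tuples [j] enumerating a given [V], over which Cauchy-Schwarz
   is applied. *)
exists (((#|pi| - #|T|)`!)%:R * B) => M.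
apply: (@le_trans _ _ (\sum_(V : {set 'I_M}) ((#|pi| - #|T|)`!)%:R *
    \sum_(j : (#|pi| - #|T|).-tuple 'I_M | uniq j && ([set x in j]%SET == V))
       fiber_sum q0 a j ^+ 2)); last first.
  rewrite -mulr_sumr ler_wpM2l//; apply: le_trans (bB M).
  by rewrite [leRHS](partition_big (fun j : (#|pi| - #|T|).-tuple 'I_M =>
    [set x in j]%SET) xpredT).
apply: ler_sum => V _.
apply: (@le_trans _ _ ((\sum_(j : (#|pi| - #|T|).-tuple 'I_M |
    uniq j && ([set x in j]%SET == V)) fiber_sum q0 a j) ^+ 2)); last first.
  apply: le_trans (sum_sq_le _ _) _.
  rewrite ler_wpM2r ?sumr_ge0// => [j _|]; first exact: sqr_ge0.
  by rewrite ler_nat; exact: card_uniq_tuples_of_set.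
rewrite ler_sqr ?nnegrE ?sumr_ge0//; last by move=> j _; exact: fiber_sum_ge0.
(* The values of the blocks outside [T] are exactly the elements of [V]: they lie in [V] by the
   choice of [T], and every element of [V] occurs in [i]. *)
rewrite (partition_big (fun i => remaining T (block_values q0 pi i))
  (fun j => uniq j && ([set x in j]%SET == V)))/=; last first.
  move=> i /andP[/andP[/andP[/forall_inP Vi D] /eqP ip] /eqP iT].
  rewrite uniq_remaining ?uniq_block_values//=.
  apply/eqP/setP => x; rewrite inE.
  apply/mapP/idP => [[t]|xV].
    by rewrite mem_enum inE -iT inE negbK => tV ->.
  have := Vi x xV; rewrite -(mem_block_values q0 ip) => /tnthP[t xt].
  by exists t => //; rewrite mem_enum inE -iT inE -xt xV.
apply: ler_sum => j _; rewrite [leRHS]big_mkcond [leLHS]big_mkcond/=.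
apply: ler_sum => i _; case: ifP => [/andP[/andP[/andP[_ ->] _] ->]//|_].
by case: ifP.
Qed.

(** The vectors are split by their partition, then by their set [T]. Each splitting costs, by
    Cauchy-Schwarz, a factor that counts the possible classes and does not depend on [M]. *)
Lemma repeated_off_bounded :
  (forall pi : {set {set 'I_k}}, finset.partition pi [set: 'I_k]%SET ->
     summable_sq a pi) ->
  (forall pi : {set {set 'I_k}}, finset.partition pi [set: 'I_k]%SET ->
     forall T : {set 'I_#|pi|}, T != finset.set0 ->
       (forall t, t \in T -> (2 <= #|block pi t|)%N) ->
       summable_offdiag a T) ->
  exists B : R, forall M,
    \sum_(V : {set 'I_M})
      (\sum_(i | repeated_off V i) `|a (map_tuple val i)|) ^+ 2 <= B.
Proof.
move=> sq sT.
have bT pi (T : {set 'I_#|pi|}) := block_class_bounded (sq pi) (sT pi ^~ T).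
have {bT} bpi pi : exists B : R, forall M,
    \sum_(V : {set 'I_M})
      (\sum_(i | repeated_off V i && (kernel_partition i == pi))
        `|a (map_tuple val i)|) ^+ 2 <= B.
  have [B bB] := choice (bT pi).
  exists (#|{set 'I_#|pi|}|%:R * \sum_T B T) => M.
  apply: (@le_trans _ _ (\sum_(V : {set 'I_M}) #|{set 'I_#|pi|}|%:R * \sum_T
      (\sum_(i | (repeated_off V i && (kernel_partition i == pi)) &&
          (off_blocks q0 V pi i == T)) `|a (map_tuple val i)|) ^+ 2)).
    apply: ler_sum => V _; apply: le_trans (sum_sq_le _ _).
    by rewrite (partition_big (off_blocks q0 V pi) xpredT).
  rewrite -mulr_sumr ler_wpM2l// exchange_big/=.
  by apply: ler_sum => T _; exact: bB.
have [B bB] := choice bpi.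
exists (#|{set {set 'I_k}}|%:R * \sum_pi B pi) => M.
apply: (@le_trans _ _ (\sum_(V : {set 'I_M}) #|{set {set 'I_k}}|%:R * \sum_pi
    (\sum_(i | repeated_off V i && (kernel_partition i == pi))
      `|a (map_tuple val i)|) ^+ 2)).
  apply: ler_sum => V _; apply: le_trans (sum_sq_le _ _).
  by rewrite (partition_big (@kernel_partition _ _) xpredT).
rewrite -mulr_sumr ler_wpM2l// exchange_big/=.
by apply: ler_sum => pi _; exact: bB.
Qed.

(** * Pairs of index vectors without a value of multiplicity one *)

Definition no_singleton (z : seq nat) : bool :=
  all (fun x => count_mem x z != 1%N) z.

(** Up to the factor [moment_bound], an upper bound for the expectation of the term attached to
    [(i, j)] in the square of the form. *)
Definition pair_weight (i j : k.-tuple nat) : R :=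
  if no_singleton (i ++ j) then `|a i| * `|a j| else 0.

Definition pair_sum M : R :=
  \sum_(i : k.-tuple 'I_M) \sum_(j : k.-tuple 'I_M)
    pair_weight (map_tuple val i) (map_tuple val j).

Lemma pair_weight_ge0 i j : 0 <= pair_weight i j.
Proof. by rewrite /pair_weight; case: ifP => // _; rewrite mulr_ge0. Qed.

Definition common M (i j : k.-tuple 'I_M) : {set 'I_M} :=
  [set x | (x \in i) && (x \in j)]%SET.

(** A value of [i] that is not common does not occur in [j], so its multiplicity in [i] is its total
    multiplicity, which is positive and different from one. *)
Lemma repeated_off_common M (i j : k.-tuple 'I_M) :
  no_singleton (map val i ++ map val j) ->
  repeated_off (common i j) i && repeated_off (common i j) j.
Proof.
move=> ns.
have count_val (l : k.-tuple 'I_M) x :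
    count_mem (val x) (map val l) = count_mem x l.
  by rewrite count_map; apply: eq_count => y /=; rewrite (inj_eq val_inj).
have key x : x \in val i ++ val j -> (count_mem x i + count_mem x j != 1)%N.
  move=> xij; rewrite -!count_val -count_cat.
  by move/allP: ns; apply; rewrite -map_cat map_f.
have count0 (l : k.-tuple 'I_M) x : x \notin l -> count_mem x l = 0%N.
  by move/count_memPn.
have count1 (l : k.-tuple 'I_M) x : x \in l -> (0 < count_mem x l)%N.
  by rewrite -has_pred1 has_count.
apply/andP; split; apply/andP; split; apply/forall_inP => x; rewrite ?inE.
- by case/andP.
- move=> xi; rewrite xi/=; apply/implyP => /count0 xj.
  have := key x; rewrite mem_cat xi xj addn0 => /(_ isT).
  by have := count1 _ _ xi; case: count => [|[]].
- by case/andP.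
- move=> xj; rewrite xj andbT; apply/implyP => /count0 xi.
  have := key x; rewrite mem_cat xj orbT xi add0n => /(_ isT).
  by have := count1 _ _ xj; case: count => [|[]].
Qed.

(** After grouping by [V = common i j], the pairs are only required to satisfy [repeated_off V]
    separately. This adds nonnegative terms, decouples [i] from [j], and leaves a square. *)
Lemma pair_sum_le M :
  pair_sum M <= \sum_(V : {set 'I_M})
      (\sum_(i | repeated_off V i) `|a (map_tuple val i)|) ^+ 2.
Proof.
rewrite /pair_sum pair_big/=.
rewrite (partition_big (fun p => common p.1 p.2) xpredT)//=.
apply: ler_sum => V _; rewrite expr2 mulr_suml.
under [leRHS]eq_bigr do rewrite mulr_sumr.
rewrite pair_big/= [leLHS]big_mkcond [leRHS]big_mkcond/=.
apply: ler_sum => -[i j] _ /=; case: eqP => [<-|_]; last first.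
  by case: ifP => // _; rewrite mulr_ge0.
rewrite /pair_weight; case: ifP => [/repeated_off_common -> //|_].
by case: ifP => // _; rewrite mulr_ge0.
Qed.

End TotalBound.

(** * Completeness of L2 *)

Section L2Completeness.
Context d (T : measurableType d) (R : realType) (P : probability T R).

(** The telescoping series of increments converges absolutely. *)
Lemma is_cvg_of_sum_dist (z : R^nat) :
  (\sum_(j <oo) `|z j.+1 - z j|%:E < +oo)%E -> cvgn z.
Proof.
set S := (X in (X < _)%E) => Sy.
have S0 : (0 <= S)%E by apply: nneseries_ge0 => n _ _; rewrite lee_fin.
have Sfin : S \is a fin_num by rewrite ge0_fin_numE.
have : cvgn [normed series (telescope z)].
  apply: nondecreasing_is_cvgn.
    by apply: nondecreasing_series => n _ _; exact: normr_ge0.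
  exists (fine S) => _ [n _ <-] /=; rewrite -lee_fin fineK// /series/= -sumEFin.
  by apply: nneseries_lim_ge => k _ _; rewrite lee_fin.
move=> /normed_cvg cz.
have -> : z = (fun n => z 0%N + series (telescope z) n).
  by apply/funext => n; exact: eq_sum_telescope.
by apply: is_cvgD => //; exact: is_cvg_cst.
Qed.

(** The Riesz-Fischer argument: a rapidly converging subsequence converges almost everywhere, and
    Fatou's lemma carries the Cauchy estimate over to its limit. *)
Lemma L2_cauchy_cvg (X : nat -> T -> R) :
  (forall n, measurable_fun setT (X n)) ->
  (forall e : R, 0 < e -> exists N, forall m n, (N <= m)%N -> (N <= n)%N ->
    (\int[P]_x ((X m x - X n x) ^+ 2)%:E <= e%:E)%E) ->
  exists2 Y : T -> R, measurable_fun setT Y &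
    forall e : R, 0 < e -> exists N, forall n, (N <= n)%N ->
    (\int[P]_x ((X n x - Y x) ^+ 2)%:E <= e%:E)%E.
Proof.
move=> mX cX.
(* These numbers sum to one. Consecutive terms of the subsequence will be within [dl j] in L2, hence
   within [2 * dl j] in L1. *)
pose dl (j : nat) : R := (2 ^ j.+1)%:R^-1.
have dl0 j : 0 < dl j by rewrite invr_gt0 ltr0n expn_gt0.
have [N0 hN0] := choice (fun j => cX (dl j ^+ 2) (exprn_gt0 2 (dl0 j))).
(* Adding up the thresholds makes [n_] monotone with [N0 j <= n_ j], and the successors ensure
   [j <= n_ j]. *)
pose n_ j := (\sum_(i < j.+1) (N0 i).+1)%N.
have n_S j : (n_ j <= n_ j.+1)%N by rewrite /n_ [leqRHS]big_ord_recr leq_addr.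
have N0n j : (N0 j <= n_ j)%N.
  by rewrite /n_ big_ord_recr/=; apply: leq_trans (leqnSn _) (leq_addl _ _).
have n_ge j : (j <= n_ j)%N.
  rewrite /n_; elim: j => // j ih; rewrite big_ord_recr/=.
  by apply: leq_ltn_trans ih _; rewrite addnS ltnS leq_addr.
pose Z j := X (n_ j).
have mZ j : measurable_fun setT (Z j) by exact: mX.
have mD j : measurable_fun setT (fun x => `|Z j.+1 x - Z j x|%:E).
  apply/measurable_EFinP; apply: measurableT_comp => //.
  exact: measurable_funB.
have mDX (Y : T -> R) n : measurable_fun setT Y ->
    measurable_fun setT (fun x => ((X n x - Y x) ^+ 2)%:E).
  by move=> mY; apply/measurable_EFinP/measurable_funX/measurable_funB.
(* AM-GM: [`|u| <= u ^+ 2 / dl j + dl j] *)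
have iD j : (\int[P]_x `|Z j.+1 x - Z j x|%:E <= (2 * dl j)%:E)%E.
  apply: (@le_trans _ _ (\int[P]_x
      (((dl j)^-1)%:E * ((Z j.+1 x - Z j x) ^+ 2)%:E + (dl j)%:E))%E).
    apply: ge0_le_integral => //.
    - by apply: emeasurable_funD => //; apply: measurable_funeM; exact: mDX.
    - move=> x _; rewrite -EFinM -EFinD lee_fin.
      set u := Z _ x - Z _ x.
      have -> : (dl j)^-1 * u ^+ 2 + dl j = (`|u| ^+ 2 + dl j ^+ 2) / dl j.
        by rewrite real_normK ?num_real// mulrDl mulrC expr2 mulfK ?gt_eqF.
      rewrite ler_pdivlMr// -subr_ge0.
      have -> : `|u| ^+ 2 + dl j ^+ 2 - `|u| * dl j
          = (`|u| - dl j) ^+ 2 + `|u| * dl j.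
        by ring.
      by rewrite addr_ge0 ?sqr_ge0// mulr_ge0// ltW.
  rewrite ge0_integralD//; last 3 first.
  - by move=> x _; rewrite -EFinM lee_fin mulr_ge0 ?sqr_ge0// invr_ge0 ltW.
  - by apply: measurable_funeM; exact: mDX.
  - by move=> x _; rewrite lee_fin ltW.
  rewrite ge0_integralZl_EFin//; last 3 first.
  - by move=> x _; rewrite lee_fin sqr_ge0.
  - exact: mDX.
  - by rewrite invr_ge0 ltW.
  rewrite integral_cst//= probability_setT mule1 mulr_natl mulr2n EFinD leeD2r//.
  apply: (@le_trans _ _ (((dl j)^-1)%:E * (dl j ^+ 2)%:E)%E).
    apply: lee_wpmul2l; first by rewrite lee_fin invr_ge0 ltW.
    exact: (hN0 j (n_ j.+1) (n_ j) (leq_trans (N0n j) (n_S j)) (N0n j)).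
  by rewrite -EFinM lee_fin expr2 mulrA mulVf ?mul1r// gt_eqF.
have intS : P.-integrable setT (fun x => \sum_(j <oo) `|Z j.+1 x - Z j x|%:E)%E.
  apply/integrableP; split.
    by apply: ge0_emeasurable_sum => // j x _ _; rewrite lee_fin.
  under eq_integral.
    move=> x _; rewrite gee0_abs; last first.
      by apply: nneseries_ge0 => j _ _; rewrite lee_fin.
    over.
  rewrite integral_nneseries//.
  apply: (@le_lt_trans _ _ (2%:E)); last exact: ltry.
  apply: le_trans (@epsilon_trick0 R 2 xpredT _) => //.
  apply: lee_nneseries => [j _ _|j _]; last exact: iD.
  by apply: integral_ge0 => x _; rewrite lee_fin.
have /= aeS := integrable_ae measurableT intS.
have {aeS} aeZ : {ae P, forall x, cvgn (Z ^~ x)}.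
  apply: filterS aeS => x /(_ I) Sfin; apply: is_cvg_of_sum_dist.
  rewrite -ge0_fin_numE//.
  by apply: nneseries_ge0 => j _ _; rewrite lee_fin.
(* The upper limit is measurable whether or not [Z] converges, and it is the limit almost
   everywhere; [fine] turns infinite values into 0. *)
pose Y x := fine (limn_esup (fun j => (Z j x)%:E)).
have mY : measurable_fun setT Y.
  apply: (measurableT_comp (fine_measurable measurableT)).
  by apply: measurable_fun_limn_esup => j; apply/measurable_EFinP.
exists Y => // e e0; have [N hN] := cX e e0; exists N => n Nn.
pose f j x := ((X n x - Z j x) ^+ 2)%:E.
have mf j : measurable_fun setT (f j) by exact: mDX.
have f0 j x : (0 <= f j x)%E by rewrite lee_fin sqr_ge0.
(* Almost everywhere [f j] tends to the square of [X n - Y], which prepares the use of Fatou's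
   lemma. *)
apply: (@le_trans _ _ (\int[P]_x limn_einf (f ^~ x))%E).
  apply: ae_ge0_le_integral => //.
  - by move=> x _; rewrite lee_fin sqr_ge0.
  - exact: mDX.
  - move=> x _; rewrite limn_einf_lim; apply: lime_ge; first exact: is_cvg_einfs.
    by apply: nearW => j; apply: le_ereal_inf_tmp => _ [i _ <-].
  - rewrite (_ : (fun x => _) = (fun x => - limn_esup (fun j => - f j x)))%E.
    by apply: measurableT_comp => //; apply: measurable_fun_limn_esup => j;
      apply: measurableT_comp.
    apply/funext => x; rewrite -limn_einfN; congr limn_einf.
    by apply/funext => j; exact/esym/oppeK.
  apply: filterS aeZ => x cZ _.
  have cY : Z ^~ x @ \oo --> Y x.
    rewrite /Y; have /cvg_limn_einf_sup[_ ->] :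
        (fun j => (Z j x)%:E) @ \oo --> (limn (Z^~ x))%:E.
      by apply: cvg_EFin; [exact: nearW|exact: cZ].
    exact: cZ.
  have /cvg_limn_einf_sup[-> _] // : f ^~ x @ \oo --> ((X n x - Y x) ^+ 2)%:E.
  apply: cvg_EFin; first exact: nearW.
  rewrite /f/= (_ : _ \o _ = (fun j => (X n x - Z j x) ^+ 2))//.
  rewrite expr2; under eq_fun do rewrite expr2.
  by apply: cvgM; apply: cvgB => //; exact: cvg_cst.
apply: le_trans (fatou _ _ _ _) _ => //.
rewrite limn_einf_lim; apply: lime_le; first exact: is_cvg_einfs.
near=> j; apply: (@le_trans _ _ (\int[P]_x f j x)%E).
  by apply: ereal_inf_lbound; exists j => //=.
apply: hN => //; apply: leq_trans (n_ge j); near: j; exact: nbhs_infty_ge.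
Unshelve. all: by end_near.
Qed.

End L2Completeness.

(** * Expectations of products of independent variables *)

Section Independence.
Import HBNNSimple.
Context d (T : measurableType d) (R : realType) (P : probability T R).

Let measurable_comp (Y : {RV P >-> R}) (g : R -> R) : measurable_fun setT g ->
  measurable_fun setT (fun w => g (Y w)).
Proof. by move=> mg; apply: measurableT_comp. Qed.

Lemma integral_nnsfun_comp (H : T -> R) (Y : {RV P >-> R})
    (G : {nnsfun R >-> R}) :
  measurable_fun setT H -> (forall w, 0 <= H w) ->
  (\int[P]_w (H w * G (Y w))%:E =
   \sum_(r \in range G)
     r%:E * \int[P]_w (H w * \1_(G @^-1` [set r]) (Y w))%:E)%E.
Proof.
move=> mH H0.
have mB r : measurable_fun setT (fun w => H w * \1_(G @^-1` [set r]) (Y w)).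
  apply: measurable_funM => //; apply: measurable_comp.
  exact: measurable_indic.
transitivity (\int[P]_w \sum_(r \in range G)
   (r * (H w * \1_(G @^-1` [set r]) (Y w)))%:E)%E.
  apply: eq_integral => w _; rewrite [in LHS](fimfunE G).
  rewrite fsumEFin//; congr (_%:E).
  rewrite !fsbig_finite//= mulr_sumr; apply: eq_bigr => r _.
  by rewrite mulrCA.
rewrite ge0_integral_fsum//; last 2 first.
- by move=> r; apply/measurable_EFinP; apply: measurable_funM.
- move=> r w _; rewrite mulrCA lee_fin mulr_ge0// -lee_fin EFinM.
  exact: nnfun_muleindic_ge0.
apply: eq_fsbigr => r; rewrite inE => -[y _ yr].
have r0 : 0 <= r by rewrite -yr.
rewrite -ge0_integralZl_EFin//.
- by move=> w _; rewrite lee_fin mulr_ge0.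
- exact/measurable_EFinP.
Qed.

(** The factorization extends from indicators to simple functions by linearity, then to [g] by
    monotone convergence. In the application [H] is the product of the other factors and [c] its
    expectation. *)
Lemma ge0_integral_comp_prod (H : T -> R) (Y : {RV P >-> R}) (c : R)
    (g : R -> R) :
  measurable_fun setT H -> (forall w, 0 <= H w) -> 0 <= c ->
  (forall B : set R, measurable B ->
    \int[P]_w (H w * \1_B (Y w))%:E = c%:E * \int[P]_w (\1_B (Y w))%:E)%E ->
  measurable_fun setT g -> (forall y, 0 <= g y) ->
  (\int[P]_w (H w * g (Y w))%:E = c%:E * \int[P]_w (g (Y w))%:E)%E.
Proof.
move=> mH H0 c0 HB mg g0.
have mEg : measurable_fun setT (EFin \o g) by exact/measurable_EFinP.
pose G := nnsfun_approx measurableT mEg.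
have cG y : (G n y)%:E @[n --> \oo] --> (g y)%:E.
  by apply: (cvg_nnsfun_approx measurableT mEg) => // x _; rewrite lee_fin.
have ndG y m n : (m <= n)%N -> G m y <= G n y.
  by move=> mn; move/lefP: (nd_nnsfun_approx measurableT mEg mn); apply.
have lim_int (K : T -> R) : measurable_fun setT K -> (forall w, 0 <= K w) ->
    (\int[P]_w (K w * G n (Y w))%:E)%E @[n --> \oo] -->
    (\int[P]_w (K w * g (Y w))%:E)%E.
  move=> mK K0.
  have -> : (\int[P]_w (K w * g (Y w))%:E =
      \int[P]_w limn (fun n => (K w * G n (Y w))%:E))%E.
    apply: eq_integral => w _; apply/esym/cvg_lim => //.
    under eq_fun do rewrite EFinM.
    by rewrite EFinM; apply: cvgeZl => //; exact: cG.
  apply: cvg_monotone_convergence => //.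
  - move=> n; apply/measurable_EFinP; apply: measurable_funM => //.
    exact: measurable_comp.
  - by move=> n w _; rewrite lee_fin mulr_ge0.
  - by move=> w _ m n mn; rewrite lee_fin ler_wpM2l// ndG.
have int1 (f : R -> R) :
    (\int[P]_w (f (Y w))%:E = \int[P]_w (cst 1 w * f (Y w))%:E)%E.
  by apply: eq_integral => w _; rewrite mul1r.
have eqG n : (\int[P]_w (H w * G n (Y w))%:E =
    c%:E * \int[P]_w (G n (Y w))%:E)%E.
  rewrite int1 !integral_nnsfun_comp// ge0_mule_fsumr.
    apply: eq_fsbigr => r _; rewrite HB// -?int1 1?muleCA//.
  (* Distributivity asks for nonnegative terms at every [r]; for negative [r] the level set of [G]
     is empty and the term vanishes. *)
  move=> r; have [r0|r0] := leP 0 r.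
    rewrite mule_ge0 ?lee_fin//; apply: integral_ge0 => w _.
    by rewrite lee_fin mulr_ge0.
  rewrite preimage_nnfun0// integral0_eq ?mule0// => w _.
  by rewrite indic0 mulr0.
have := lim_int H mH H0; under eq_fun do rewrite eqG.
move/(cvg_lim (@ereal_hausdorff R)) => <-; apply: cvg_lim => //.
apply: cvgeZl => //; rewrite int1; under eq_fun do rewrite int1.
exact: lim_int.
Qed.

End Independence.

Section ProductFormula.
Context d (T : measurableType d) (R : realType) (P : probability T R).
Variable eps : nat -> {RV P >-> R}.
Hypothesis ind : mutually_independent eps.

Let measurable_comp j (g : R -> R) : measurable_fun setT g ->
  measurable_fun setT (fun w => g (eps j w)).
Proof. by move=> mg; apply: measurableT_comp. Qed.

Let measurable_prod_comp (s : seq nat) (g : nat -> R -> R) :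
  (forall j, measurable_fun setT (g j)) ->
  measurable_fun setT (fun w => \prod_(j <- s) g j (eps j w)).
Proof. by move=> mg; apply: measurable_prod => j _; exact: measurable_comp. Qed.

(** The product of indicators is the indicator of an intersection, whose probability factors by
    independence. *)
Lemma integral_prod_indic (t : seq nat) (A : nat -> set R) : uniq t ->
  (forall j, measurable (A j)) ->
  (\int[P]_w (\prod_(j <- t) \1_(A j) (eps j w))%:E =
   \prod_(j <- t) \int[P]_w (\1_(A j) (eps j w))%:E)%E.
Proof.
move=> ut mA.
have mpre j : measurable (eps j @^-1` A j).
  by rewrite -[X in measurable X]setTI; exact: measurable_funP.
have intA (B : set T) : measurable B -> (\int[P]_w (\1_B w)%:E = P B)%E.
  by move=> mB; rewrite integral_indic// setIT.
pose J := [fset j in t]%fset.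
have Jt : perm_eq J t by apply: uniq_perm => // j; rewrite in_fset.
transitivity (P (\bigcap_(j in [set` J]) (eps j @^-1` A j))).
  rewrite -intA; last by apply: fin_bigcap_measurable => //; exact: finite_fset.
  apply: eq_integral => w _; congr (_%:E); rewrite !indicE.
  have [|] := boolP (w \in \bigcap_(j in [set` J]) eps j @^-1` A j).
    rewrite inE => wA; rewrite big_seq big1// => j jt.
    by rewrite indicE mem_set//; apply: wA; rewrite /= in_fset.
  move=> wA; have [j jt wj] : exists2 j, j \in t & ~ A j (eps j w).
    apply: contrapT => h; move/negP: wA; apply; rewrite inE => j /=.
    by rewrite in_fset => jt; apply: contrapT => ?; apply: h; exists j.
  by rewrite (big_rem j)//= indicE memNset// mul0r.
rewrite ind// (perm_big _ Jt)/=; apply: eq_bigr => j _.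
by rewrite -intA.
Qed.

(* Hybrid form for the induction on [s]: the factors over [s] are arbitrary,
   those over [t] are still indicators. *)
Lemma ge0_integral_prod_indic (s t : seq nat) (A : nat -> set R)
    (g : nat -> R -> R) : uniq (s ++ t) ->
  (forall j, measurable_fun setT (g j)) -> (forall j y, 0 <= g j y) ->
  (forall j, measurable (A j)) -> (forall j, j \in t -> g j = \1_(A j)) ->
  (forall j, j \in s -> \int[P]_w (g j (eps j w))%:E < +oo)%E ->
  (\int[P]_w (\prod_(j <- s ++ t) g j (eps j w))%:E =
   \prod_(j <- s ++ t) \int[P]_w (g j (eps j w))%:E)%E.
Proof.
elim: s t A g => [|x s ih] t A g /=.
  move=> ut mg g0 mA gA _.
  under eq_integral do rewrite big_seq
    (eq_bigr _ (fun j jt => congr1 (@^~ _) (gA j jt))) -big_seq.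
  rewrite integral_prod_indic// [RHS]big_seq [LHS]big_seq.
  by apply: eq_bigr => j /gA ->.
move=> /andP[xst ust] mg g0 mA gA gfin.
have gtfin j : j \in s ++ t -> (\int[P]_w (g j (eps j w))%:E < +oo)%E.
  rewrite mem_cat => /orP[js|jt]; first by rewrite gfin// inE js orbT.
  apply: (@le_lt_trans _ _ (\int[P]_w 1%:E)%E); last first.
    by rewrite integral_cst//= probability_setT mule1 ltry.
  apply: ge0_le_integral => //.
  - by move=> w _; rewrite lee_fin.
  - by apply/measurable_EFinP; exact: measurable_comp.
  - by move=> w _; rewrite lee_fin gA// indicE lern1 leq_b1.
have int0 j : (0 <= \int[P]_w (g j (eps j w))%:E)%E.
  by apply: integral_ge0 => w _; rewrite lee_fin.
pose c := \prod_(j <- s ++ t) fine (\int[P]_w (g j (eps j w))%:E).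
have cE : (\prod_(j <- s ++ t) \int[P]_w (g j (eps j w))%:E)%E = c%:E.
  rewrite /c -prodEFin big_seq [RHS]big_seq; apply: eq_bigr => j jst.
  by rewrite fineK// ge0_fin_numE// gtfin.
rewrite big_cons cE muleC -(@ge0_integral_comp_prod _ _ _ _
  (fun w => \prod_(j <- s ++ t) g j (eps j w)))//.
- by apply: eq_integral => w _; rewrite big_cons mulrC.
- exact: measurable_prod_comp.
- by move=> w; apply: prodr_ge0 => j _.
- by apply: prodr_ge0 => j _; rewrite fine_ge0.
(* It remains to treat an indicator in place of [g x]: [x] then joins the indicator list and the
   induction hypothesis applies to [s] and [x :: t]. *)
move=> B mB; pose g' j := if j == x then \1_B else g j.
pose A' j := if j == x then B else A j.
have g'E j : j \in s ++ t -> g' j = g j.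
  by rewrite /g'; case: eqP => // -> xin; rewrite xin in xst.
have xst' : perm_eq (s ++ x :: t) (x :: s ++ t).
  by rewrite -[x :: t]cat1s perm_catCA.
have prodE w : \prod_(j <- s ++ x :: t) g' j (eps j w) =
    \prod_(j <- s ++ t) g j (eps j w) * \1_B (eps x w).
  rewrite (perm_big _ xst')/= big_cons {1}/g' eqxx mulrC; congr (_ * _).
  by apply: eq_big_seq => j /g'E ->.
have cBE : (\prod_(j <- s ++ x :: t) \int[P]_w (g' j (eps j w))%:E =
    c%:E * \int[P]_w (\1_B (eps x w))%:E)%E.
  rewrite (perm_big _ xst')/= big_cons {1}/g' eqxx muleC -cE; congr (_ * _)%E.
  by apply: eq_big_seq => j /g'E ->.
rewrite -cBE -(ih (x :: t) A' g').
- by apply: eq_integral => w _; rewrite prodE.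
- by rewrite (perm_uniq xst')/= xst.
- by move=> j; rewrite /g'; case: ifP => // _; exact: measurable_indic.
- by move=> j y; rewrite /g'; case: ifP.
- by move=> j; rewrite /A'; case: ifP.
- move=> j; rewrite inE /g' /A'; case: eqP => //= _; exact: gA.
- by move=> j js; rewrite g'E ?mem_cat ?js// gtfin// mem_cat js.
Qed.

Lemma ge0_integral_prod (s : seq nat) (g : nat -> R -> R) : uniq s ->
  (forall j, measurable_fun setT (g j)) -> (forall j y, 0 <= g j y) ->
  (forall j, j \in s -> \int[P]_w (g j (eps j w))%:E < +oo)%E ->
  (\int[P]_w (\prod_(j <- s) g j (eps j w))%:E =
   \prod_(j <- s) \int[P]_w (g j (eps j w))%:E)%E.
Proof.
move=> us mg g0 gfin; have := @ge0_integral_prod_indic s [::] (fun=> setT) g.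
by rewrite cats0; apply.
Qed.

End ProductFormula.

Section Centered.
Context d (T : measurableType d) (R : realType) (P : probability T R).
Variable eps : nat -> {RV P >-> R}.
Hypothesis ind : mutually_independent eps.

(** The positive and negative parts of [eps x] have the same finite expectation. The nonnegative
    product formula applies to both, and the two results cancel. *)
Lemma ge0_integral_prod_centered (x : nat) (t : seq nat) (g : nat -> R -> R) :
  uniq (x :: t) ->
  (forall j, measurable_fun setT (g j)) ->
  (forall j y, j \in t -> 0 <= g j y) ->
  (forall j, j \in t -> \int[P]_w (g j (eps j w))%:E < +oo)%E ->
  P.-integrable setT (EFin \o eps x) -> (\int[P]_w (eps x w)%:E = 0)%E ->
  (\int[P]_w (\prod_(j <- t) g j (eps j w) * eps x w)%:E = 0)%E.
Proof.
move=> uxt mg g0 gfin ix Ex0.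
have xt : x \notin t by case/andP: uxt.
have t0 w : 0 <= \prod_(j <- t) g j (eps j w).
  by rewrite big_seq; apply: prodr_ge0 => j jt; exact: g0.
pose C := (\prod_(j <- t) \int[P]_w (g j (eps j w))%:E)%E.
have fact (u : R -> R) : measurable_fun setT u -> (forall y, 0 <= u y) ->
    (\int[P]_w (u (eps x w))%:E < +oo)%E ->
    (\int[P]_w (\prod_(j <- t) g j (eps j w) * u (eps x w))%:E =
     C * \int[P]_w (u (eps x w))%:E)%E.
  move=> mu u0 ufin.
  (* Truncation at 0 makes all factors nonnegative, as the product formula requires, without
     changing those over [t]. *)
  pose h j y := if j == x then u y else Num.max (g j y) 0.
  have hx y : h x y = u y by rewrite /h eqxx.
  have ht j y : j \in t -> h j y = g j y.
    move=> jt; rewrite /h; case: eqP => [jx|_]; first by rewrite -jx jt in xt.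
    by rewrite max_l// g0.
  transitivity (\int[P]_w (\prod_(j <- x :: t) h j (eps j w))%:E)%E.
    apply: eq_integral => w _; rewrite big_cons hx mulrC; congr (_ * _)%:E.
    by apply: eq_big_seq => j jt; rewrite ht.
  rewrite ge0_integral_prod//.
  - rewrite big_cons muleC; congr (_ * _)%E.
      by apply: eq_big_seq => j jt; apply: eq_integral => w _; rewrite -(ht j).
    by apply: eq_integral => w _; rewrite hx.
  - move=> j; rewrite /h; case: (j == x) => //.
    by apply: measurable_maxr => //; exact: measurable_cst.
  - by move=> j y; rewrite /h; case: ifP => // _; rewrite le_max lexx orbT.
  - move=> j; rewrite inE => /predU1P[->|jt].
      by under eq_integral do rewrite hx.
    under eq_integral do rewrite ht//.
    exact: gfin.
have posE (K : T -> R) : (forall w, 0 <= K w) ->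
    (fun w => (K w * eps x w)%:E)^\+%E =
      (fun w => (K w * Num.max (eps x w) 0)%:E) /\
    (fun w => (K w * eps x w)%:E)^\-%E =
      (fun w => (K w * Num.max (- eps x w) 0)%:E).
  move=> K0; split; apply/funext => w;
    rewrite ?funeposE ?funenegE -?EFinN -EFin_max; congr _%:E.
    by rewrite maxr_pMr// mulr0.
  by rewrite maxr_pMr// mulr0 mulrN.
have [p1 n1] := posE (cst 1) (fun=> ler01).
have e1 : EFin \o eps x = (fun w => (cst 1 w * eps x w)%:E).
  by apply/funext => w /=; rewrite mul1r.
have pfin : (\int[P]_w (Num.max (eps x w) 0)%:E < +oo)%E.
  have := integral_funepos_lt_pinfty measurableT ix; rewrite e1 p1.
  by under eq_integral do rewrite mul1r.
have nfin : (\int[P]_w (Num.max (- eps x w) 0)%:E < +oo)%E.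
  have := integral_funeneg_lt_pinfty measurableT ix; rewrite e1 n1.
  by under eq_integral do rewrite mul1r.
have p0 : (0 <= \int[P]_w (Num.max (eps x w) 0)%:E)%E.
  by apply: integral_ge0 => w _; rewrite lee_fin le_max lexx orbT.
have n0 : (0 <= \int[P]_w (Num.max (- eps x w) 0)%:E)%E.
  by apply: integral_ge0 => w _; rewrite lee_fin le_max lexx orbT.
have eq_pn : (\int[P]_w (Num.max (eps x w) 0)%:E =
    \int[P]_w (Num.max (- eps x w) 0)%:E)%E.
  have : (\int[P]_w (EFin \o eps x) w = 0)%E by exact: Ex0.
  rewrite e1 integralE p1 n1.
  under eq_integral do rewrite mul1r.
  under [X in (_ - X)%E]eq_integral do rewrite mul1r.
  move: pfin nfin p0 n0.
  case: (\int[P]_w (Num.max (eps x w) 0)%:E)%E => [p| |]//.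
  case: (\int[P]_w (Num.max (- eps x w) 0)%:E)%E => [n| |]// _ _ _ _.
  by rewrite -EFinB => -[/eqP]; rewrite subr_eq0 => /eqP ->.
have [pt nt] := posE _ t0.
rewrite integralE pt nt.
rewrite (fact (fun y => Num.max y 0)) ?(fact (fun y => Num.max (- y) 0))//.
(* Subtracting equal terms gives 0 only if they are finite, so [C] must be shown finite. *)
- rewrite eq_pn subee// fin_numM//; last by rewrite ge0_fin_numE.
  rewrite /C big_seq; elim/big_ind: _ => // [a b|j jt]; first exact: fin_numM.
  rewrite ge0_fin_numE ?gfin//; apply: integral_ge0 => w _.
  rewrite lee_fin; exact: g0.
- by apply: measurable_maxr => //; exact: measurableT_comp.
- by move=> y; rewrite le_max lexx orbT.
- by apply: measurable_maxr.
- by move=> y; rewrite le_max lexx orbT.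
Qed.

(* Each signed factor, over [s], is split into its positive and negative parts,
   which join the nonnegative factors over [t]. *)
Lemma integral_prod_centered (x : nat) (s t : seq nat) (g : nat -> R -> R) :
  uniq (x :: s ++ t) ->
  (forall j, measurable_fun setT (g j)) ->
  (forall j y, j \in t -> 0 <= g j y) ->
  (forall j, j \in s ++ t ->
    P.-integrable setT (fun w => (g j (eps j w))%:E)) ->
  P.-integrable setT (EFin \o eps x) -> (\int[P]_w (eps x w)%:E = 0)%E ->
  P.-integrable setT
    (fun w => (\prod_(j <- s ++ t) g j (eps j w) * eps x w)%:E) ->
  (\int[P]_w (\prod_(j <- s ++ t) g j (eps j w) * eps x w)%:E = 0)%E.
Proof.
move=> uxst mg g0 ig ix Ex0.
elim: s t g uxst mg g0 ig => [|y s ih] t g uxst mg g0 ig iH.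
  apply: ge0_integral_prod_centered => // j jt.
  have /integrableP[_] := ig j jt.
  by under eq_integral do rewrite /= ger0_norm ?g0//.
pose gs (sg : R) j z := if j == y then Num.max (sg * g j z) 0 else g j z.
have yst : y \notin s ++ t by case/and3P: uxst.
have perm_yst : perm_eq (s ++ y :: t) (y :: s ++ t).
  by rewrite -[y :: t]cat1s perm_catCA.
have prodE sg w : \prod_(j <- s ++ y :: t) gs sg j (eps j w) * eps x w =
   Num.max (sg * g y (eps y w)) 0 *
   (\prod_(j <- s ++ t) g j (eps j w) * eps x w).
  rewrite (perm_big _ perm_yst)/= big_cons {1}/gs eqxx mulrA; congr (_ * _ * _).
  apply: eq_big_seq => j jst; rewrite /gs; case: eqP => // jy.
  by rewrite jy in jst; rewrite jst in yst.
have mgs sg j : measurable_fun setT (gs sg j).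
  rewrite /gs; case: (j == y) => //; apply: measurable_maxr => //.
  exact: measurable_funM.
have mprod (h : nat -> R -> R) (l : seq nat) :
    (forall j, measurable_fun setT (h j)) ->
    measurable_fun setT (fun w => (\prod_(j <- l) h j (eps j w) * eps x w)%:E).
  move=> mh; apply/measurable_EFinP; apply: measurable_funM => //.
  by apply: measurable_prod => j _; exact: measurableT_comp.
have sg_le (sg z : R) : `|sg| = 1 -> `|Num.max (sg * z) 0| <= `|z|.
  move=> sg1; rewrite -[leRHS]mul1r -sg1 -normrM; case: (leP (sg * z) 0) => //.
  by rewrite normr0.
have igs sg : `|sg| = 1 ->
    P.-integrable setT
      (fun w => (\prod_(j <- s ++ y :: t) gs sg j (eps j w) * eps x w)%:E).
  move=> sg1; apply: le_integrable iH => //; first exact: mprod.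
  move=> w _; rewrite prodE !abse_EFin lee_fin big_cons -mulrA.
  rewrite !(normrM _ (_ * eps x w)).
  by rewrite ler_wpM2r// sg_le.
have Egs sg : `|sg| = 1 ->
    (\int[P]_w (\prod_(j <- s ++ y :: t) gs sg j (eps j w) * eps x w)%:E = 0)%E.
  move=> sg1; apply: ih => //.
  - by rewrite /= (perm_mem perm_yst) (perm_uniq perm_yst).
  - move=> j z; rewrite inE /gs; case: eqP => [_ _|_ /=].
      by rewrite le_max lexx orbT.
    exact: g0.
  - move=> j jst; rewrite (perm_mem perm_yst) in jst.
    apply: le_integrable (ig j jst) => //.
      by apply/measurable_EFinP; apply: measurableT_comp.
    move=> w _; rewrite !abse_EFin lee_fin /gs; case: eqP => // _; exact: sg_le.
  - exact: igs.
(* Zero is written as the difference of the two vanishing integrals, which recombines the two parts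
   of the factor at [y]. *)
rewrite -[RHS](subee (x := 0%E))// -[X in (X - _)%E](Egs 1) ?normr1//.
rewrite -[X in (_ - X)%E](Egs (-1)) ?normrN1//.
rewrite -integralB_EFin//;
  [|by apply: igs; rewrite normr1|by apply: igs; rewrite normrN1].
apply: eq_integral => w _; rewrite -EFinB !prodE -mulrBl big_cons -mulrA.
congr (_ * _)%:E.
rewrite mul1r mulN1r; case: (leP (g y (eps y w)) 0) => gy.
  by rewrite max_l ?oppr_ge0// sub0r opprK.
by rewrite max_r ?oppr_le0 ?ltW// subr0.
Qed.

End Centered.

(** * Moments of products of the [eps] *)

Lemma norm_prod_le_sum (R : realDomainType) (I : eqType) (z : seq I)
    (e : I -> R) :
  z != [::] -> `|\prod_(y <- z) e y| <= \sum_(y <- z) `|e y| ^+ size z.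
Proof.
move=> z0.
have [y yz ymax] : exists2 y, y \in z & forall x, x \in z -> `|e x| <= `|e y|.
  elim: z z0 => // x [|x' z] ih _.
    by exists x => [|u]; rewrite inE// => /eqP ->.
  have [y yz ymax] := ih isT.
  have [xy|yx] := leP `|e x| `|e y|.
    by exists y => [|u]; rewrite inE ?yz ?orbT// => /predU1P[->//|/ymax].
  exists x => [|u]; first exact: mem_head.
  by rewrite inE => /predU1P[->//|/ymax/le_trans]; apply; exact: ltW.
(* The product is at most the power of its largest factor, which is one term of the sum. *)
apply: (@le_trans _ _ (`|e y| ^+ size z)).
  have -> : `|e y| ^+ size z = \prod_(x <- z) `|e y|.
    by rewrite big_const_seq count_predT iter_mulr_1.
  rewrite normr_prod big_seq [leRHS]big_seq.
  by apply: ler_prod => x xz; rewrite normr_ge0 ymax.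
rewrite (big_rem y)//= lerDl sumr_ge0// => x _; exact: exprn_ge0.
Qed.

Section Moments.
Context d (T : measurableType d) (R : realType) (P : probability T R) (k : nat).
Variable eps : nat -> {RV P >-> R}.
Hypothesis k0 : (1 <= k)%N.
Hypothesis eps_iid : iid eps.
Hypothesis eps_mean : (forall i, 'E_P[eps i] = 0)%E.
Hypothesis eps_mom : (forall i, 'E_P[fun w => (eps i w ^+ (2 * k))%R] < +oo)%E.

Let n := (2 * k)%N.

Let even_pow (y : R) : y ^+ n = `|y| ^+ n.
Proof. by rewrite /n !exprM real_normK ?num_real. Qed.

(** The moment is an integral against the law of [eps i], and all these laws agree. *)
Lemma integral_even_moment_const i :
  (\int[P]_w (eps i w ^+ n)%:E = \int[P]_w (eps 0%N w ^+ n)%:E)%E.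
Proof.
have push j : (\int[P]_w (eps j w ^+ n)%:E =
    \int[distribution P (eps j)]_y (y ^+ n)%:E)%E.
  rewrite ge0_integral_distribution//.
    by apply/measurable_EFinP; exact: exprn_measurable.
  by move=> y; rewrite lee_fin even_pow exprn_ge0.
rewrite !push; apply: eq_measure_integral => A mA _.
exact: (eps_iid.2 i 0%N A mA).
Qed.

Lemma integrable_even_moment i :
  P.-integrable setT (fun w => (eps i w ^+ n)%:E).
Proof.
apply/integrableP; split.
  by apply/measurable_EFinP; exact: measurable_funX.
have := eps_mom i; rewrite unlock; apply: le_lt_trans.
rewrite le_eqVlt; apply/orP; left; apply/eqP; apply: eq_integral => w _.
by rewrite even_pow abse_EFin ger0_norm// exprn_ge0.
Qed.

(** The power [r] of a number is dominated by one plus its power [n], by comparing its absolute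
    value with 1. *)
Lemma integrable_moment i r : (r <= n)%N ->
  P.-integrable setT (fun w => (eps i w ^+ r)%:E).
Proof.
move=> rn; have i1 : P.-integrable setT (fun w => (1 + eps i w ^+ n)%:E).
  under eq_fun do rewrite EFinD.
  apply: integrableD => //; first exact: finite_measure_integrable_cst.
  exact: integrable_even_moment.
apply: le_integrable i1 => //.
  by apply/measurable_EFinP; exact: measurable_funX.
move=> w _; rewrite !abse_EFin lee_fin even_pow.
rewrite [leRHS]ger0_norm ?addr_ge0// normrX.
have [e1|e1] := leP `|eps i w| 1.
  by apply: (@le_trans _ _ 1); rewrite ?exprn_ile1// lerDl exprn_ge0.
by apply: le_trans (ler_weXn2l (ltW e1) rn) _; rewrite lerDr.
Qed.

Definition moment_bound : R := n%:R * fine (\int[P]_w (eps 0%N w ^+ n)%:E)%E.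

Lemma moment_bound_ge0 : 0 <= moment_bound.
Proof.
rewrite mulr_ge0// fine_ge0//; apply: integral_ge0 => w _.
by rewrite lee_fin even_pow exprn_ge0.
Qed.

Let measurable_prod_eps (z : seq nat) :
  measurable_fun setT (fun w => \prod_(y <- z) eps y w).
Proof. by apply: measurable_prod => j _. Qed.

Let integrable_sum_even (z : seq nat) :
  P.-integrable setT (fun w => (\sum_(y <- z) `|eps y w| ^+ n)%:E).
Proof.
under eq_fun do rewrite -sumEFin.
apply: integrable_sum => // y; under eq_fun do rewrite -even_pow.
move=> _; exact: integrable_even_moment.
Qed.

Lemma integrable_prod_eps (z : seq nat) : size z = n ->
  P.-integrable setT (fun w => (\prod_(y <- z) eps y w)%:E).
Proof.
move=> zn; apply: le_integrable (integrable_sum_even z) => //.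
  exact/measurable_EFinP.
move=> w _; rewrite !abse_EFin lee_fin [leRHS]ger0_norm ?sumr_ge0//.
rewrite -zn; apply: norm_prod_le_sum.
by rewrite -size_eq0 zn muln_eq0 negb_or/= -lt0n.
Qed.

Lemma integral_prod_eps_le (z : seq nat) : size z = n ->
  (`|\int[P]_w (\prod_(y <- z) eps y w)%:E| <= moment_bound%:E)%E.
Proof.
move=> zn; apply: le_trans (le_abse_integral _ _ _) _ => //.
  exact/measurable_EFinP.
apply: (@le_trans _ _ (\int[P]_w (\sum_(y <- z) `|eps y w| ^+ n)%:E)%E).
  apply: ge0_le_integral => //.
  - by apply: measurableT_comp => //; exact/measurable_EFinP.
  - by have /integrableP[] := integrable_sum_even z.
  - move=> w _; rewrite abse_EFin lee_fin -zn; apply: norm_prod_le_sum.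
    by rewrite -size_eq0 zn muln_eq0 negb_or/= -lt0n.
under eq_integral do rewrite -sumEFin.
rewrite integral_sum//; last first.
  by move=> y; under eq_fun do rewrite -even_pow; exact: integrable_even_moment.
under eq_bigr => y _ do under eq_integral do rewrite -even_pow.
have mfin := integrable_fin_num measurableT (integrable_even_moment 0).
under eq_bigr => y _ do rewrite integral_even_moment_const -(fineK mfin).
by rewrite sumEFin big_const_seq count_predT zn iter_addr_0 -mulr_natl.
Qed.

(** Grouping equal indices turns the factors other than [eps x] into powers of distinct variables,
    so independence and centering apply. *)
Lemma integral_prod_eps_eq0 (z : seq nat) x :
  size z = n -> count_mem x z = 1%N ->
  (\int[P]_w (\prod_(y <- z) eps y w)%:E = 0)%E.
Proof.
move=> zn zx.
have xz : x \in z by rewrite -has_pred1 has_count zx.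
pose z' := rem x z; have pz : perm_eq z (x :: z') by exact: perm_to_rem.
have xz' : x \notin z'.
  have := zx; rewrite (seq.permP pz)/= eqxx add1n => -[/eqP].
  by rewrite -leqn0 leqNgt -has_count has_pred1.
have prodE w : \prod_(y <- z) eps y w =
    \prod_(j <- undup z' ++ [::]) (eps j w ^+ count_mem j z') * eps x w.
  rewrite cats0 (perm_big _ pz)/= big_cons mulrC; congr (_ * _).
  by rewrite -big_undup_iterop_count.
under eq_integral do rewrite prodE.
apply: (@integral_prod_centered _ _ _ _ _ eps_iid.1 x (undup z') [::]
  (fun j y => y ^+ count_mem j z')) => //.
- by rewrite cats0/= mem_undup xz' undup_uniq.
- move=> j _; apply: integrable_moment; apply: leq_trans (count_size _ _) _.
  by rewrite -zn size_rem// leq_pred.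
- have := @integrable_moment x 1; rewrite muln_gt0 k0 => /(_ isT).
  by under eq_fun do rewrite expr1.
- by have := eps_mean x; rewrite unlock.
- by have := integrable_prod_eps zn; under eq_fun do rewrite prodE.
Qed.

End Moments.

(** * Partial sums of the polynomial form *)

Section Widening.
Context (k : nat).

Definition below (N M : nat) (i : k.-tuple 'I_M) : bool :=
  all (fun x : 'I_M => (x < N)%N) i.

Lemma sum_widen (V : nmodType) (F : k.-tuple nat -> V) N M : (N <= M)%N ->
  \sum_(i : k.-tuple 'I_N) F (map_tuple val i) =
  \sum_(i : k.-tuple 'I_M | below N i) F (map_tuple val i).
Proof.
move=> NM; pose h (i : k.-tuple 'I_N) := map_tuple (widen_ord NM) i.
have h_inj : injective h.
  move=> i j /(congr1 val) /= /inj_map ij.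
  apply/val_inj/ij => x y /(congr1 val)/= xy; exact/val_inj.
have valh i : map_tuple val (h i) = map_tuple val i.
  by apply/val_inj; rewrite /= -map_comp.
transitivity (\sum_(i in finset.imset h (mem [set: k.-tuple 'I_N]%SET))
  F (map_tuple val i)).
  rewrite big_imset/=; last by move=> i j _ _; exact: h_inj.
  by apply: eq_big => i; rewrite ?inE// valh.
apply: eq_bigl => i; apply/imsetP/allP => [[j _ ->] x|iN].
  by move=> /mapP[y _ ->] /=.
have iN' q : (tnth i q < N)%N by apply: iN; exact: mem_tnth.
exists [tuple Ordinal (iN' q) | q < k]; rewrite ?inE//.
by apply: eq_from_tnth => q; rewrite tnth_map tnth_mktuple; exact: val_inj.
Qed.

End Widening.

Section PairSum.
Context (R : realType) (k : nat) (a : k.-tuple nat -> R).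

(** Among the pairs below [M], those with both vectors below [N] make up [pair_sum a N]; the mixed
    pairs have nonnegative weight and are dropped. *)
Lemma pair_sum_tail N M : (N <= M)%N ->
  \sum_(i : k.-tuple 'I_M | ~~ below N i)
    \sum_(j : k.-tuple 'I_M | ~~ below N j)
      pair_weight a (map_tuple val i) (map_tuple val j) <=
  pair_sum a M - pair_sum a N.
Proof.
move=> NM; rewrite lerBrDl /pair_sum.
rewrite (sum_widen (fun i : k.-tuple nat => \sum_(j : k.-tuple 'I_N)
  pair_weight a i (map_tuple val j)) NM).
rewrite [leRHS](bigID (@below k N M))/=; apply: lerD; apply: ler_sum => i _.
  rewrite (sum_widen (pair_weight a (map_tuple val i)) NM).
  rewrite [leRHS](bigID (@below k N M))/= lerDl; apply: sumr_ge0 => j _.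
  exact: pair_weight_ge0.
rewrite [leRHS](bigID (@below k N M))/= lerDr; apply: sumr_ge0 => j _.
exact: pair_weight_ge0.
Qed.

Lemma le_pair_sum N M : (N <= M)%N -> pair_sum a N <= pair_sum a M.
Proof.
move=> NM; rewrite -subr_ge0; apply: le_trans (pair_sum_tail NM).
by do 2 apply: sumr_ge0 => ? _; exact: pair_weight_ge0.
Qed.

(** The sums are nondecreasing and bounded, so beyond some [N] they stay within [e] of their
    supremum. *)
Lemma pair_sum_cauchy (B e : R) : (forall M, pair_sum a M <= B) -> 0 < e ->
  exists N, forall n m, (N <= n)%N -> pair_sum a m - pair_sum a n <= e.
Proof.
move=> SB e0; have hs : has_sup (range (pair_sum a)).
  by split; [exists (pair_sum a 0), 0%N|exists B => _ [M _ <-]].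
have [_ [N _ <-] hN] := sup_adherent e0 hs; exists N => n m Nn.
rewrite lerBlDl; apply: (@le_trans _ _ (sup (range (pair_sum a)))).
  by apply: ub_le_sup; [exact: hs.2|exists m].
by rewrite -lerBlDr; apply: le_trans (ltW hN) _; exact: le_pair_sum.
Qed.

End PairSum.

Section SecondMoment.
Context d (T : measurableType d) (R : realType) (P : probability T R) (k : nat).
Variables (eps : nat -> {RV P >-> R}) (a : k.-tuple nat -> R).
Hypothesis k0 : (1 <= k)%N.
Hypothesis eps_iid : iid eps.
Hypothesis eps_mean : (forall i, 'E_P[eps i] = 0)%E.
Hypothesis eps_mom : (forall i, 'E_P[fun w => (eps i w ^+ (2 * k))%R] < +oo)%E.

Let X := polynomial_form a eps.
Let C := moment_bound k eps.

Lemma measurable_polynomial_form M : measurable_fun setT (X M).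
Proof.
apply: measurable_sum => i; apply: measurable_funM => //.
by apply: measurable_prod => q _.
Qed.

Lemma polynomial_formE M w : X M w =
  \sum_(i : k.-tuple 'I_M) a (map_tuple val i) * \prod_(y <- map val i) eps y w.
Proof.
by apply: eq_bigr => i _; rewrite big_map big_tuple.
Qed.

Lemma pair_expectation_le (i j : k.-tuple nat) :
  (\int[P]_w (a i * a j * \prod_(y <- i ++ j) eps y w)%:E <=
   (C * pair_weight a i j)%:E)%E.
Proof.
have sij : size (i ++ j) = (2 * k)%N.
  by rewrite size_cat !size_tuple mul2n addnn.
under eq_integral do rewrite EFinM.
rewrite integralZl//; last exact: (integrable_prod_eps k0 eps_mom sij).
rewrite /pair_weight; case: ifPn => [_|].
  apply: le_trans (lee_abs _) _; rewrite abseM [leRHS]EFinM muleC lee_pmul//.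
    exact: (integral_prod_eps_le k0 eps_iid eps_mom sij).
  by rewrite abse_EFin lee_fin normrM.
move=> /allPn[x _]; rewrite negbK => /eqP xij.
rewrite (integral_prod_eps_eq0 k0 eps_iid eps_mean eps_mom sij xij).
by rewrite mule0 mulr0.
Qed.

(** The increment involves only vectors with a component at least [N], so its square involves only
    pairs of such vectors, which [pair_sum_tail] controls. *)
Lemma polynomial_form_dist N M : (N <= M)%N ->
  (\int[P]_w ((X M w - X N w) ^+ 2)%:E <=
   (C * (pair_sum a M - pair_sum a N))%:E)%E.
Proof.
move=> NM.
pose A (i : k.-tuple 'I_M) := a (map_tuple val i).
pose Z (i : k.-tuple 'I_M) w := \prod_(y <- map val i) eps y w.
have XE w : X M w - X N w = \sum_(i : k.-tuple 'I_M | ~~ below N i) A i * Z i w.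
  rewrite !polynomial_formE.
  rewrite (sum_widen (fun i : k.-tuple nat => a i * \prod_(y <- i) eps y w) NM).
  by rewrite (bigID (@below k N M))/= addrAC subrr add0r.
have sqE w : (X M w - X N w) ^+ 2 =
    \sum_(i : k.-tuple 'I_M | ~~ below N i)
    \sum_(j : k.-tuple 'I_M | ~~ below N j)
      A i * A j * \prod_(y <- map val i ++ map val j) eps y w.
  rewrite XE expr2 mulr_suml; apply: eq_bigr => i _; rewrite mulr_sumr.
  by apply: eq_bigr => j _; rewrite big_cat/= mulrACA.
have iij (i j : k.-tuple 'I_M) : P.-integrable setT
    (fun w => (A i * A j * \prod_(y <- map val i ++ map val j) eps y w)%:E).
  under eq_fun do rewrite EFinM.
  apply: integrableZl => //; apply: (integrable_prod_eps k0 eps_mom).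
  by rewrite size_cat !size_map !size_tuple mul2n addnn.
under eq_integral do rewrite sqE -sumEFin.
rewrite integral_sum//; last first.
  by move=> i; under eq_fun do rewrite -sumEFin; apply: integrable_sum => // j.
apply: (@le_trans _ _ (\sum_(i : k.-tuple 'I_M | ~~ below N i)
    \sum_(j : k.-tuple 'I_M | ~~ below N j)
      (C * pair_weight a (map_tuple val i) (map_tuple val j))%:E)%E).
  apply: lee_sum => i _; under eq_integral do rewrite -sumEFin.
  rewrite integral_sum//; apply: lee_sum => j _.
  exact: (pair_expectation_le (map_tuple val i) (map_tuple val j)).
under eq_bigr do rewrite sumEFin -mulr_sumr.
rewrite sumEFin -mulr_sumr lee_fin ler_wpM2l ?moment_bound_ge0//.
exact: pair_sum_tail.
Qed.

Lemma polynomial_form_cauchy (B e : R) :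
  (forall M, pair_sum a M <= B) -> 0 < e ->
  exists N, forall m n, (N <= m)%N -> (N <= n)%N ->
    (\int[P]_w ((X m w - X n w) ^+ 2)%:E <= e%:E)%E.
Proof.
move=> SB e0; have C0 : 0 <= C by exact: moment_bound_ge0.
(* Dividing [e] by [C + 1] avoids a division by zero, since [C] is only known to be nonnegative. *)
have C1 : 0 < C + 1 by rewrite ltr_wpDl.
have [N hN] := pair_sum_cauchy SB (divr_gt0 e0 C1).
have est m n : (N <= n)%N -> (n <= m)%N ->
    (\int[P]_w ((X m w - X n w) ^+ 2)%:E <= e%:E)%E.
  move=> Nn nm; apply: le_trans (polynomial_form_dist nm) _; rewrite lee_fin.
  apply: (@le_trans _ _ (C * (e / (C + 1)))); first by rewrite ler_wpM2l ?hN.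
  by rewrite mulrCA ler_piMr ?(ltW e0)// ler_pdivrMr// mul1r lerDl.
exists N => m n Nm Nn; have [nm|/ltnW mn] := leqP n m; first exact: est.
by under eq_integral do rewrite -sqrrN opprB; exact: est.
Qed.

(** As [k] is positive, no index vector lies below 0. The distance estimate with [N = 0] thus bounds
    the second moment of each partial sum. *)
Lemma polynomial_form0 w : X 0%N w = 0.
Proof.
by rewrite /X /polynomial_form big1// => i; have [] := tnth i (Ordinal k0).
Qed.

End SecondMoment.

(** * From second moments to convergence in the L2 norm *)

Section L2Norm.
Context d (T : measurableType d) (R : realType) (P : probability T R).

Lemma Lnorm2E (f : T -> R) :
  ('N[P]_2%:E[EFin \o f] = (\int[P]_w (f w ^+ 2)%:E) `^ 2^-1)%E.
Proof.
rewrite unlock; congr (_ `^ _)%E; apply: eq_integral => w _.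
by rewrite abse_EFin poweR_EFin powR_mulrn// real_normK ?num_real.
Qed.

Lemma Lfun2P (f : T -> R) : measurable_fun setT f ->
  (\int[P]_w (f w ^+ 2)%:E < +oo)%E -> f \in Lfun P 2%:E.
Proof.
move=> mf ff; rewrite inE; apply/andP; split; rewrite inE//=.
by rewrite /finite_norm Lnorm2E poweR_lty.
Qed.

Lemma converges_in_L2_cauchy (X : nat -> T -> R) :
  (forall n, measurable_fun setT (X n)) ->
  (forall n, \int[P]_w (X n w ^+ 2)%:E < +oo)%E ->
  (forall e : R, 0 < e -> exists N, forall m n, (N <= m)%N -> (N <= n)%N ->
    (\int[P]_x ((X m x - X n x) ^+ 2)%:E <= e%:E)%E) ->
  converges_in_L2 P X.
Proof.
move=> mX X2 cX; have XL n : X n \in Lfun P 2%:E by exact: Lfun2P.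
split=> //; have [Y mY XY] := L2_cauchy_cvg mX cX; exists Y.
  have [N hN] := XY 1 ltr01.
  have XYL : (X N \- Y)%R \in Lfun P 2%:E.
    apply: Lfun2P; first exact: measurable_funB.
    by apply: le_lt_trans (hN N (leqnn N)) _; rewrite ltry.
  (* Square integrability of [Y] follows from that of [X N] and [X N \- Y] by linearity of
     [Lfun]. *)
  have -> : Y = (-1) *: (X N \- Y : T -> R) + X N.
    by apply/funext => w /=; rewrite !fctE /= scaleN1r opprB subrK.
  by apply: (Lfun_submod_closed P (lee1n 2)).2.
apply/fine_cvgP; split.
  have [N hN] := XY 1 ltr01; exists N => // n Nn /=.
  rewrite Lnorm2E ge0_fin_numE ?poweR_ge0// poweR_lty//.
  by apply: le_lt_trans (hN n Nn) _; rewrite ltry.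
(* The tolerance is squared because the norm is the square root of the integral. *)
apply/cvgrPdist_le => e e0; have [N hN] := XY (e ^+ 2) (exprn_gt0 2 e0).
exists N => // n Nn /=; rewrite sub0r normrN ger0_norm ?fine_ge0 ?Lnorm_ge0//.
rewrite -lee_fin fineK; last first.
  rewrite Lnorm2E ge0_fin_numE ?poweR_ge0// poweR_lty//.
  by apply: le_lt_trans (hN n Nn) _; rewrite ltry.
rewrite Lnorm2E; have -> : (e%:E = ((e ^+ 2)%:E) `^ 2^-1)%E.
  by rewrite poweR_EFin -powR_mulrn ?(ltW e0)// -powRrM mulfV ?powRr1 ?(ltW e0).
apply: gt0_ler_poweR;
  rewrite ?invr_ge0 ?in_itv/= ?leey ?andbT ?lee_fin ?sqr_ge0//.
  by apply: integral_ge0 => w _; rewrite lee_fin sqr_ge0.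
exact: hN.
Qed.

End L2Norm.

Theorem proposition3p2 (d : measure_display) (Omega : measurableType d)
    (R : realType) (P : probability Omega R) (k : nat)
    (eps : nat -> {RV P >-> R}) (a : k.-tuple nat -> R) :
  (1 <= k)%N ->
  iid eps ->
  (forall i, 'E_P[eps i] = 0)%E ->
  (forall i, 'E_P[fun w => (eps i w ^+ 2)%R] = 1)%E ->
  (forall i, 'E_P[fun w => (eps i w ^+ (2 * k))%R] < +oo)%E ->
  (forall pi : {set {set 'I_k}}, finset.partition pi [set: 'I_k]%SET ->
     summable_sq a pi) ->
  (forall pi : {set {set 'I_k}}, finset.partition pi [set: 'I_k]%SET ->
     forall T : {set 'I_#|pi|}, T != finset.set0 ->
       (forall t, t \in T -> (2 <= #|block pi t|)%N) ->
       summable_offdiag a T) ->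
  converges_in_L2 P (polynomial_form a eps).
Proof.
move=> k0 eps_iid eps_mean _ eps_mom sq off.
have [B hB] := repeated_off_bounded (Ordinal k0) sq off.
have SB M : pair_sum a M <= B := le_trans (pair_sum_le a M) (hB M).
apply: converges_in_L2_cauchy => [n|n|e].
- exact: measurable_polynomial_form.
- have := polynomial_form_dist a k0 eps_iid eps_mean eps_mom (leq0n n).
  under eq_integral do rewrite polynomial_form0// subr0.
  by move/le_lt_trans; apply; rewrite ltry.
- exact: polynomial_form_cauchy.
Qed.
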